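(* Let $(\mathbf{X},Y)$ be a $(d+1)$-dimensional random vector with continuous univariate marginal distribution functions and connecting copula $A\in\mathcal{C}^{d+1}$. Then $$T(Y,\mathbf{X})=\phi(\psi(A)),$$ where $\phi:\mathcal{C}^2\to\mathbb{R}$ denotes Spearman's footrule, $\phi(C)=6\int_{\mathbb{I}}C(t,t)\,\mathrm{d}\lambda(t)-2$.
   Context: Let $\mathbb{I}=[0,1]$, $d\ge 1$ an integer, $\lambda$ Lebesgue measure on $\mathbb{I}$. $\mathcal{C}^{k}$ is the family of all $k$-dimensional copulas. For $A\in\mathcal{C}^{d+1}$, $\mu_A$ denotes the probability measure on $\mathbb{I}^{d+1}$ with distribution function $A$; $A^{1:d}$ is the marginal of $A$ with respect to the first $d$ coordinates (for $d=1$, $\mu_{A^{1:d}}=\lambda$); $K_A:\mathbb{I}^d\times\mathcal{B}(\mathbb{I})\to\mathbb{I}$ is (a version of) the Markov kernel of $A$, i.e. the regular conditional distribution of the last coordinate given the first $d$ coordinates. The map $\psi:\mathcal{C}^{d+1}\to\mathcal{C}^2$ is defined by $$\psi(A)(s,t)=\int_{\mathbb{I}^d}K_A(\mathbf{u},[0,s])\,K_A(\mathbf{u},[0,t])\,\mathrm{d}\mu_{A^{1:d}}(\mathbf{u}),\qquad (s,t)\in\mathbb{I}^2.$$ The quantity $T$ is defined by $$T(Y,\mathbf{X})=\frac{\int_{\mathbb{R}}\mathrm{var}\big(P(Y\ge y\mid\mathbf{X})\big)\,\mathrm{d}P^{Y}(y)}{\int_{\mathbb{R}}\mathrm{var}\big(\mathbf{1}_{\{Y\ge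 y\}}\big)\,\mathrm{d}P^{Y}(y)},$$ where $P^Y$ is the law of $Y$. The connecting copula of $(\mathbf{X},Y)$ is the distribution function of $(F_1(X_1),\dots,F_d(X_d),G(Y))$, where $F_i$ and $G$ are the distribution functions of $X_i$ and $Y$. *)

(* Defs.v *)
From HB Require Import structures.
From mathcomp Require Import all_boot all_order all_algebra.
From mathcomp Require Import all_classical all_reals all_analysis.
From mathcomp Require Import measurable_realfun.

Set Implicit Arguments.
Unset Strict Implicit.
Unset Printing Implicit Defensive.

Import Order.TTheory GRing.Theory Num.Theory.
Import numFieldNormedType.Exports.
Local Open Scope classical_set_scope.
Local Open Scope ring_scope.

Section random_vectors.
Context (disp : measure_display) (R : realType) (Omega : measurableType disp)
  (P : probability Omega R).

Definition distribution_function (Z : {RV P >-> R}) (z : R) : R :=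
  fine (cdf Z z).

Definition random_vector (d : nat) (X : 'I_d -> {RV P >-> R}) (w : Omega) :
  d.-tuple R := [tuple X i w | i < d].

(* [g] is a version of the conditional probability P(E | X): it is
   sigma(X)-measurable, P-integrable and integrates to P(E & G) over every
   G in sigma(X) (the sets of sigma(X) are the preimages by X of the
   measurable subsets of R^d) *)
Definition is_cond_prob (d : nat) (X : 'I_d -> {RV P >-> R}) (E : set Omega)
    (g : Omega -> R) : Prop :=
  [/\ measurable_fun setT
        (g : g_sigma_algebra_preimageType (random_vector X) -> R),
      P.-integrable setT (EFin \o g) &
      forall G, g_sigma_algebra_preimage (random_vector X) G ->
        (\int[P]_(w in G) (g w)%:E)%E = P (E `&` G)].

(* some version of P(E | X); versions agree P-almost surely, so the variance
   below does not depend on the choice *)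
Definition cond_prob (d : nat) (X : 'I_d -> {RV P >-> R}) (E : set Omega) :
  Omega -> R := xget (cst 0) [set g | is_cond_prob X E g].

Lemma measurable_random_vector (d : nat) (X : 'I_d -> {RV P >-> R}) :
  measurable_fun setT (random_vector X).
Proof.
apply/measurable_fun_tnthP => i.
have -> : (@tnth _ R)^~ i \o random_vector X = X i.
  by apply/funext => w /=; rewrite tnth_mktuple.
exact: measurable_funPT.
Qed.

Lemma cond_probP (d : nat) (X : 'I_d -> {RV P >-> R}) (E : set Omega) :
  measurable E -> is_cond_prob X E (cond_prob X E).
Proof.
move=> mE; have mX := measurable_random_vector X.
suff [g gP] : exists g, is_cond_prob X E g by exact: (@xgetPex _ _ _ (ex_intro _ g gP)).
pose Z : {mfun Omega >-> d.-tuple R} := HB.pack (random_vector X)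
  (isMeasurableFun.Build _ _ _ _ (random_vector X) mX).
have mZ : measurable_fun setT Z by exact: measurable_funPT.
have mZI B : measurable B -> measurable (Z @^-1` B).
  by move=> mB; rewrite -[X in measurable X]setTI; apply: mZ.
pose PX := distribution P Z.
have PE : (P E < +oo)%E by rewrite ltey_eq fin_num_measure.
pose PEm : {finite_measure set Omega -> \bar R} := mfrestr mE PE.
pose nuZ : {measure set (d.-tuple R) -> \bar R} := pushforward PEm Z.
pose nu0 : {measure set (d.-tuple R) -> \bar R} := nuZ mZ.
have nu0fin : fin_num_fun nu0.
  by move=> B mB; apply: fin_num_measure; exact: mZI.
pose nu : {finite_measure set (d.-tuple R) -> \bar R} := HB.pack (nu0 : set _ -> _)
  (Measure.on nu0) (Measure_isFinite.Build _ _ _ nu0 nu0fin).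
have nuE B : nu B = P (E `&` Z @^-1` B) by rewrite setIC.
have nuPX : nu `<< PX.
  apply/null_content_dominatesP => B mB PXB0; rewrite nuE.
  have mZB := mZI _ mB.
  apply/eqP; rewrite -measure_le0 -[leRHS]PXB0.
  by rewrite le_measure ?inE//; exact: measurableI.
have [f [f0 ffin intf fE]] := @radon_nikodym_sigma_finite _ _ _ PX nu nuPX.
exists (fine \o f \o Z).
have EfZ : EFin \o (fine \o f \o Z) = f \o Z.
  by apply/funext => w /=; rewrite fineK.
have mf := measurable_int PX intf.
have mfZ := measurableT_comp mf mZ.
split.
- move=> _ B mB; rewrite setTI; exists ((fine \o f) @^-1` B); last by rewrite setTI.
  rewrite -[X in measurable X]setTI.
  by apply: (measurableT_comp _ mf).
- rewrite EfZ; apply/integrableP; split => //.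
  move/integrableP : intf => [_]; rewrite ge0_integral_pushforward//.
  exact: measurableT_comp.
- move=> _ [B mB <-]; rewrite setTI -nuE fE// ge0_integral_pushforward//; last first.
    exact: measurable_funTS.
  by apply: eq_integral => w _ /=; rewrite fineK.
Qed.

Definition coefT (d : nat) (Y : {RV P >-> R}) (X : 'I_d -> {RV P >-> R}) : R :=
  fine (\int[distribution P Y]_y
          'V_P[cond_prob X [set w | (y <= Y w)%R]])%E /
  fine (\int[distribution P Y]_y
          'V_P[(\1_[set w | (y <= Y w)%R] : Omega -> R)])%E.

(* distribution function of (F_1(X_1), ..., F_d(X_d), G(Y)); the point of
   I^(d+1) is split into its first [d] coordinates and its last one *)
Definition connecting_copula (d : nat) (X : 'I_d -> {RV P >-> R})
    (Y : {RV P >-> R}) (u : d.-tuple R) (v : R) : R :=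
  fine (P [set w | (forall i, distribution_function (X i) (X i w) <= tnth u i)
                   /\ distribution_function Y (Y w) <= v]).

End random_vectors.

Section copulas.
Context (R : realType) (d : nat).

Definition box (u : d.-tuple R) : set (d.-tuple R) :=
  [set x | forall i, tnth x i \in `[0, tnth u i]].

Definition unit_cube : set (d.-tuple R) := box [tuple 1 | _ < d].

(* [mu] is the measure with distribution function [A]. Measures on I^(d+1) are
   seen as measures on R^d * R; the corner (1, ..., 1) forces [mu] to be
   concentrated on I^(d+1) whenever A(1, ..., 1) = 1 *)
Definition is_copula_measure (A : d.-tuple R -> R -> R)
    (mu : probability (d.-tuple R * R)%type R) : Prop :=
  forall u v, unit_cube u -> v \in `[0, 1] ->
    mu (box u `*` `[0, v]) = (A u v)%:E.

HB.instance Definition _ := isMeasurableFun.Build _ _ _ _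
  (@fst (d.-tuple R) R) measurable_fst.

Definition marginal (mu : probability (d.-tuple R * R)%type R) :
  probability (d.-tuple R) R :=
  distribution mu (fst : {mfun (d.-tuple R * R)%type >-> d.-tuple R}).

(* [K] is a version of the conditional distribution of the last coordinate
   given the first [d] ones *)
Definition is_markov_kernel (mu : probability (d.-tuple R * R)%type R)
    (K : R.-pker (d.-tuple R) ~> R) : Prop :=
  forall (E : set (d.-tuple R)) (F : set R), measurable E -> measurable F ->
    mu (E `*` F) = (\int[marginal mu]_(u in E) K u F)%E.

Definition psi (mu : probability (d.-tuple R * R)%type R)
    (K : R.-pker (d.-tuple R) ~> R) (s t : R) : R :=
  \int[marginal mu]_(u in unit_cube) 
    (fine (K u `[0, s]%classic) * fine (K u `[0, t]%classic)).

End copulas.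

(* Spearman's footrule *)
Definition phi (R : realType) (C : R -> R -> R) : R :=
  6 * (\int[@lebesgue_measure R]_(t in `[0, 1]) C t t) - 2.

(* Main.v *)
Require Import Defs.
From HB Require Import structures.
From mathcomp Require Import all_boot all_order all_algebra.
From mathcomp Require Import all_classical all_reals all_analysis.
From mathcomp Require Import measurable_realfun.
From mathcomp Require Import ring.
Import Order.TTheory GRing.Theory Num.Theory.
Import numFieldNormedType.Exports.
Local Open Scope classical_set_scope.
Local Open Scope ring_scope.

(** Put [Z_i = F_i(X_i)] and [V = G(Y)]. Everything rests on one identity: for
    every [y], writing [t = G(y)], the variable [1 - K(Z, [0, t])] is a version
    of [P(Y >= y | X)].

    The copula measure prescribes [P(Z <= u, V <= t)] on the unit cube, so its
    marginal is the law of [Z] and [K(Z, [0, t])] has the right integral over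
    each event [{Z <= u}]. It has to have it over every event of sigma(X), which
    may be larger than sigma(Z) since [F_i] need not be injective. But an
    orthant [{X <= x}] differs from [{Z <= F(x)}] only where some
    [F_i(X_i) = F_i(x_i)], and this event is null because [F_i(X_i)] has no atom
    (continuity of [F_i]); as the orthants generate the Borel sets and are
    stable under intersection, integrals over the [{X <= x}] determine those
    over all of sigma(X) ([eq_integral_preimage_orthant]). This gives
    [kernel_cdf_is_cond_prob], a version of [P(V <= t | X)]; and [{Y < y}]
    coincides with [{V <= t}] up to a null event ([ge_event_ae]).

    Two versions of a conditional probability agree almost surely, hence have
    the same variance, and
      [var P(Y >= y | X) = E (K(Z, [0, t])^2) - t^2 = psi(t, t) - t^2],
    while [var 1_{Y >= y} = t - t^2]. Since [G(Y)] is uniform on the unit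
    interval ([ge0_integral_distribution_function]), integrating in [y] against
    the law of [Y] amounts to integrating in [t] over [[0, 1]]: the numerator of
    the coefficient is [int psi(t, t) dt - 1/3], its denominator is
    [1/2 - 1/3 = 1/6], and the quotient is [6 int psi(t, t) dt - 2]. *)

(** * Measures determined by closed rays and by orthants *)

Section orthants.
Context {R : realType}.

Lemma measurable_closed_ray :
  @measurable _ R = <<s [set A | exists x : R, A = `]-oo, x]%classic] >>.
Proof.
rewrite [LHS]RGenOInfty.measurableE eqEsubset; split => A.
  apply: smallest_sub; first exact: smallest_sigma_algebra.
  move=> _ [x ->]; rewrite -setCitvl; apply: sigma_algebraC.
  by apply: sub_sigma_algebra; exists x.
apply: smallest_sub; first exact: smallest_sigma_algebra.
move=> _ [x ->]; rewrite -setCitvr; apply: sigma_algebraC.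
by apply: sub_sigma_algebra; exists x.
Qed.

(** Closed rays generate the Borel sets and are stable under intersection. The
    carrier is the one on which the Lebesgue measure lives, for the sake of the
    comparison made in [ge0_integral_distribution_function]. *)
Lemma eq_measure_closed_ray (m1 m2 : {measure set (measurableTypeR R) -> \bar R}) :
    (forall x : R, m1 `]-oo, x]%classic = m2 `]-oo, x]%classic) ->
    (forall x : R, (m1 `]-oo, x]%classic < +oo)%E) ->
  forall A, measurable A -> m1 A = m2 A.
Proof.
move=> m12 m1oo; apply: (@measure_unique _ R (measurableTypeR R)
    [set A | exists x : R, A = `]-oo, x]%classic] (fun k => `]-oo, k%:R]%classic)).
- exact: measurable_closed_ray.
- move=> _ _ [x ->] [y ->]; exists (Num.min x y).
  by apply/seteqP; split => z/=; rewrite !in_itv/= le_min => /andP.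
- by move=> k; exists k%:R.
- rewrite -subTset => x _; exists (Num.truncn x).+1 => //=.
  by rewrite in_itv/= ltW// truncnS_gt.
- by move=> _ [x ->].
- by move=> k; exact: m1oo.
Qed.

(** Orthants, unlike the boxes of the unit cube, exhaust the whole space, which
    makes them suitable for random vectors with arbitrary range. *)
Definition orthant {d} (a : d.-tuple R) : set (d.-tuple R) :=
  [set x | forall i, tnth x i <= tnth a i].

Lemma orthantE {d} (a : d.-tuple R) :
  orthant a = \bigcap_(i in [set: 'I_d]) ((@tnth _ R)^~ i @^-1` `]-oo, tnth a i]).
Proof.
apply/seteqP; split => [x ax i _|x ax i].
  by rewrite /= in_itv/=.
by have := ax i I; rewrite /= in_itv/=.
Qed.

Lemma measurable_orthant {d} (a : d.-tuple R) : measurable (orthant a).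
Proof.
rewrite orthantE; apply: fin_bigcap_measurable => // i _.
rewrite -[X in measurable X]setTI; exact: measurable_tnth.
Qed.

Lemma measurable_tuple_orthant d :
  @measurable _ (d.-tuple R) = <<s range (@orthant d) >>.
Proof.
rewrite eqEsubset; split; last first.
  apply: smallest_sub; first exact: sigma_algebra_measurable.
  by move=> _ [a _ <-]; exact: measurable_orthant.
pose T := g_sigma_algebraType (range (@orthant d)).
have mid : measurable_fun [set: T] (fun x : T => x : d.-tuple R).
  apply/measurable_fun_tnthP => i.
  apply: (measurability _ measurable_closed_ray) => _ [_ [x ->] <-].
  (* a half-space is an increasing union of orthants *)
  have -> : [set: T] `&` (@tnth _ R)^~ i @^-1` `]-oo, x] =
      \bigcup_k orthant [tuple if j == i then x else k%:R | j < d].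
    rewrite setTI; apply/seteqP; split => [u /= ux|u [k _ /(_ i)]]; last first.
      by rewrite tnth_mktuple eqxx /= in_itv.
    pose M := \sum_(j < d) `|tnth u j|.
    exists (Num.truncn M).+1 => // j; rewrite tnth_mktuple.
    have [->|_] := eqVneq j i; first by move: ux; rewrite in_itv.
    rewrite (le_trans (ler_norm _))// ltW// (le_lt_trans _ (truncnS_gt _))//.
    by rewrite /M (bigD1 j)//= lerDl sumr_ge0.
  apply: bigcup_measurable => k _; apply: sub_sigma_algebra.
  by eexists.
move=> A mA; have := mid measurableT A mA.
by rewrite setTI.
Qed.

Lemma eq_measure_orthant d (m1 m2 : {measure set (d.-tuple R) -> \bar R}) :
    (forall a, m1 (orthant a) = m2 (orthant a)) ->
    (forall a, (m1 (orthant a) < +oo)%E) ->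
  forall A, measurable A -> m1 A = m2 A.
Proof.
move=> m12 m1oo; apply: (measure_unique
    (range (@orthant d)) (fun k => orthant [tuple k%:R | _ < d])).
- exact: measurable_tuple_orthant.
- move=> _ _ [a _ <-] [b _ <-].
  exists [tuple Num.min (tnth a i) (tnth b i) | i < d] => //.
  apply/seteqP; split => [x abx|x [ax bx] i]; last first.
    by rewrite tnth_mktuple le_min ax bx.
  by split => i; have := abx i; rewrite tnth_mktuple le_min => /andP[].
- by move=> k; exists [tuple k%:R | _ < d].
- rewrite -subTset => u _; pose M := \sum_(j < d) `|tnth u j|.
  exists (Num.truncn M).+1 => // j; rewrite tnth_mktuple.
  rewrite (le_trans (ler_norm _))// ltW// (le_lt_trans _ (truncnS_gt _))//.
  by rewrite /M (bigD1 j)//= lerDl sumr_ge0.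
- by move=> _ [a _ <-].
- by move=> k; exact: m1oo.
Qed.

End orthants.

(** * The probability integral transform *)

Section probability_integral_transform.
Context {disp : measure_display} {R : realType}
  {Omega : measurableType disp} {P : probability Omega R} (Z : {RV P >-> R}).
Let F := distribution_function Z.

Lemma distribution_functionE z : (F z)%:E = P [set w | Z w <= z].
Proof. by rewrite /F /distribution_function fineK ?fin_num_measure. Qed.

Lemma distribution_function_ge0 z : 0 <= F z.
Proof. by rewrite -lee_fin distribution_functionE. Qed.

Lemma distribution_function_le1 z : F z <= 1.
Proof. 
rewrite -lee_fin /F /distribution_function fineK ?fin_num_measure//.
exact: cdf_le1.
 Qed.

Lemma distribution_function_nd : {homo F : x y / x <= y}.
Proof.
move=> x y xy; rewrite /F /distribution_function.
by rewrite fine_le ?fin_num_measure// cdf_nondecreasing.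
Qed.

Lemma measurable_distribution_function : measurable_fun setT F.
Proof. by apply: nondecreasing_measurable => //; exact: distribution_function_nd. Qed.

Hypothesis cF : continuous F.

(** For [t < 1] the set [{F <= t}] is a ray bounded above by its supremum [s];
    it contains [s] and, by continuity, [F s = t], so that [{F(Z) <= t}] is
    [{Z <= s}], an event of probability [F s]. The ray is empty only when
    [t = 0]. *)
Lemma probability_integral_transform t : 0 <= t <= 1 ->
  P [set w | F (Z w) <= t] = t%:E.
Proof.
move=> /andP[t0]; rewrite le_eqVlt => /predU1P[->|t1].
  rewrite -(@probability_setT _ _ _ P); congr (P _).
  by apply/seteqP; split => // w _; exact: distribution_function_le1.
have Fy : F z @[z --> +oo] --> (1 : R) by exact/fine_cvg/cvg_cdfy1.
have FNy : F z @[z --> -oo] --> (0 : R) by exact/fine_cvg/cvg_cdfNy0.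
pose A := [set z | F z <= t].
have ubA : has_ubound A.
  have [M [_ hM]] := cvgr_gt _ Fy _ t1.
  exists M => z /= Azt; rewrite leNgt; apply/negP => /hM.
  by rewrite ltNge Azt.
have [A0|/set0P/negP/negPn/eqP A0] := pselect (A !=set0); last first.
  have : ~ 0 < t.
    move=> t0'; have [M [_ hM]] := cvgr_lt _ FNy _ t0'.
    suff : A (M - 1) by rewrite A0.
    by apply/ltW/hM; rewrite ltrBlDr ltrDl.
  move=> /negP; rewrite -leNgt => t_le0.
  have -> : t = 0 by apply/le_anti; rewrite t0 t_le0.
  rewrite (_ : [set w | _] = set0) ?measure0//.
  rewrite -subset0 => w /= Fw; suff : A (Z w) by rewrite A0.
  exact: le_trans Fw t0.
pose s := sup A.
have Fs : F s <= t.
  have cA : closed A.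
    rewrite [A](_ : _ = F @^-1` [set x | x <= t])//.
    by apply: preimage_closed => //; exact: closed_le.
  exact/(cA s)/closure_sup.
have Fs' : t <= F s.
  rewrite leNgt; apply/negP => Fst.
  have h : \forall z \near s^'+, F z < t.
    by apply: (cvgr_lt _ _ _ Fst); apply: cvg_at_right_filter; exact: cF.
  have [z [sz Fz]] : exists z, s < z /\ F z < t.
    near s^'+ => z; exists z; split; near: z; first exact: nbhs_right_gt.
    exact: h.
  move: sz; rewrite ltNge; apply/negP/negPn.
  exact: (ub_le_sup ubA (ltW Fz)).
have <- : F s = t by apply/le_anti; rewrite Fs Fs'.
rewrite distribution_functionE; congr (P _); apply/seteqP.
split => w /= Zw; first exact: (ub_le_sup ubA (le_trans Zw Fs)).
exact: (distribution_function_nd _ _ Zw).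
Unshelve. all: by end_near. Qed.

(** Although [F] may be constant on intervals, [F(Z)] has no atom: for every
    [e > 0] the event [{F(Z) = c}] lies in [{c - e < F(Z) <= c}], whose
    probability is at most [e]. *)
Lemma distribution_function_fiber0 c : P [set w | F (Z w) = c] = 0%E.
Proof.
have mFZ : measurable_fun setT (F \o Z).
  by apply: measurableT_comp => //; exact: measurable_distribution_function.
have mle t : measurable [set w | F (Z w) <= t].
  rewrite -[X in measurable X]setTI.
  have -> : [set w | F (Z w) <= t] = (F \o Z) @^-1` `]-oo, t].
    by apply/seteqP; split => w; rewrite /= in_itv.
  exact: mFZ.
have [c01|c01] := boolP (0 <= c <= 1); last first.
  rewrite (_ : [set w | _] = set0) ?measure0// -subset0 => w /= Fc.
  by move: c01; rewrite -Fc distribution_function_ge0 distribution_function_le1.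
have mc : measurable [set w | F (Z w) = c].
  rewrite -[X in measurable X]setTI.
  have -> : [set w | F (Z w) = c] = (F \o Z) @^-1` [set c] by [].
  exact: mFZ.
apply/eqP; rewrite -measure_le0; apply/lee_addgt0Pr => e e0; rewrite add0e.
have /andP[c0 c1] := c01.
have [ce|ce] := leP e c; last first.
  apply: (@le_trans _ _ (P [set w | F (Z w) <= c])).
    by rewrite le_measure ?inE// => w /= ->.
  by rewrite probability_integral_transform// lee_fin ltW.
have -> : e%:E = (P [set w | (F (Z w) <= c)%R] - P [set w | (F (Z w) <= c - e)%R])%E.
  rewrite !probability_integral_transform//; first by rewrite -EFinB; congr EFin; ring.
  by rewrite subr_ge0 ce (le_trans _ c1)// gerBl ltW.
rewrite leeBrDr ?fin_num_measure// -measureU//.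
  rewrite le_measure ?inE//; first exact: measurableU.
  by move=> w /= [->//|/le_trans]; apply; rewrite gerBl ltW.
rewrite -subset0 => w /= [->]; apply/negP; rewrite -ltNge.
by rewrite ltrBlDr ltrDl.
Qed.

End probability_integral_transform.

(** The image of the law of [Z] under its own distribution function is the
    uniform law on the unit interval. *)
Lemma ge0_integral_distribution_function (disp : measure_display)
    (R : realType) (Omega : measurableType disp) (P : probability Omega R)
    (Z : {RV P >-> R}) (h : R -> \bar R) :
    continuous (distribution_function Z) ->
    measurable_fun (`[0, 1] : set R) h ->
    (forall t, t \in `[0, 1] -> (0 <= h t)%E) ->
  (\int[distribution P Z]_z h (distribution_function Z z) =
   \int[lebesgue_measure]_(t in `[0%R, 1%R]) h t)%E.
Proof.
move=> cF mh h0; set F := distribution_function Z.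
have m01 : measurable (`[0%R, 1%R] : set R) by [].
have mF : measurable_fun setT F := measurable_distribution_function Z.
pose FZ : {mfun R >-> measurableTypeR R} :=
  HB.pack (F : R -> measurableTypeR R)
    (isMeasurableFun.Build _ _ R (measurableTypeR R) F mF).
pose m := distribution (distribution P Z) FZ.
pose u := uniform_prob (@ltr01 R).
have uE A : measurable A -> u A = lebesgue_measure (A `&` `[0%R, 1%R]).
  move=> mA; rewrite /u /uniform_prob integral_uniform_pdf.
  rewrite (eq_integral (cst 1%E)); last first.
    move=> t /[!inE] -[_ /= t01]; rewrite /uniform_pdf; move: t01.
    by rewrite in_itv/= => ->; rewrite subr0 invr1.
  by rewrite integral_cst ?mul1e//; exact: measurableI.
have F01 z : F z \in `[0%R, 1%R].
  by rewrite in_itv/= distribution_function_ge0 distribution_function_le1.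
have mE A : measurable A -> m A = u A.
  apply: (@eq_measure_closed_ray R m u) => x.
    rewrite [LHS](_ : _ = P [set w | F (Z w) <= x]); last first.
      suff <- : Z @^-1` (F @^-1` `]-oo, x]) = [set w | F (Z w) <= x] by [].
      by apply/seteqP; split => w; rewrite /= in_itv.
    rewrite [RHS]uE//.
    have [x0|x0] := ltP x 0.
      rewrite [X in P X](_ : _ = set0).
        rewrite [X in lebesgue_measure X](_ : _ = set0) ?measure0//.
        rewrite -subset0 => z /= []; rewrite !in_itv/= => zx /andP[z0 _].
        by have := lt_le_trans x0 (le_trans z0 zx); rewrite ltxx.
      rewrite -subset0 => w /= Fx; have := le_lt_trans Fx x0.
      by rewrite ltNge distribution_function_ge0.
    have [x1|x1] := leP x 1.
      rewrite probability_integral_transform ?x0//.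
      rewrite [X in lebesgue_measure X](_ : _ = `[0, x]%classic).
        rewrite lebesgue_measure_itv/= lte_fin.
        have [_|x0'] := ltP 0 x; rewrite ?sube0//; congr EFin.
        exact/le_anti/andP.
      apply/seteqP; split => z /=; rewrite !in_itv/=.
        by move=> [-> /andP[->]].
      by move=> /andP[-> zx]; split => //; exact: le_trans zx x1.
    rewrite [X in P X](_ : _ = setT).
      rewrite probability_setT [X in lebesgue_measure X](_ : _ = `[0, 1]%classic).
        by rewrite lebesgue_measure_itv/= lte_fin ltr01 sube0.
      apply/seteqP; split => z /=; first by case.
      rewrite !in_itv/= => /andP[-> z1]; split => //.
      exact: le_trans z1 (ltW x1).
    apply/seteqP; split => w //= _.
    exact: le_trans (distribution_function_le1 _ _) (ltW x1).
  exact: le_lt_trans (probability_le1 _ _) (ltry 1).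
transitivity (\int[m]_(t in `[0%R, 1%R]) h t)%E.
  rewrite [RHS]ge0_integral_pushforward//; last by move=> t /set_mem; exact: h0.
  rewrite [F @^-1` _](_ : _ = setT)//.
  by apply/seteqP; split => z _ //; exact: F01.
rewrite (eq_measure_integral u); last by move=> A mA _; exact: mE.
rewrite integral_mkcond integral_uniform ?subr0 ?invr1 ?mul1e//.
- by rewrite -integral_mkcondr setIid.
- by have /(measurable_restrictT h m01) := mh.
- by move=> t; rewrite patchE; case: ifPn => // /set_mem; exact: h0.
Qed.

(** * Variance and null events *)

Section variance.
Context {disp : measure_display} {R : realType}
  {Omega : measurableType disp} (P : probability Omega R).

Lemma unit_valued_Lfun2 (f : Omega -> R) : measurable_fun setT f ->
  (forall w, 0 <= f w <= 1) -> f \in Lfun P 2%:E.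
Proof.
move=> mf f01; apply/andP; split; rewrite inE//= /finite_norm unlock /=.
apply: poweR_lty; apply: le_lt_trans (ltry 1).
rewrite -[leRHS]mul1e -(@probability_setT _ _ _ P).
rewrite -integral_cst//; apply: ge0_le_integral => //=.
- apply/measurable_EFinP; apply: (measurableT_comp (measurable_powR _)).
  exact: measurableT_comp.
- move=> w _; rewrite probability_setT lee_fin powR_mulrn//.
  have /andP[f0 f1] := f01 w.
  by rewrite ger0_norm// expr_le1.
Qed.

Lemma variance_ae_eq (f g : Omega -> R) :
    measurable_fun setT f -> measurable_fun setT g ->
    {ae P, forall w, f w = g w} -> ('V_P[f] = 'V_P[g])%E.
Proof.
move=> mf mg fg; rewrite /variance covariance.unlock.
have -> : ('E_P[f] = 'E_P[g])%E.
  rewrite expectation.unlock; apply: ae_eq_integral => //.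
  - exact/measurable_EFinP.
  - exact/measurable_EFinP.
  - by apply: filterS fg => w ->.
set c := fine _; rewrite expectation.unlock; apply: ae_eq_integral => //.
- by apply/measurable_EFinP; apply: measurable_funM; exact: measurable_funB.
- by apply/measurable_EFinP; apply: measurable_funM; exact: measurable_funB.
- by apply: filterS fg => w /= fgw _; rewrite !fctE /= fgw.
Qed.

End variance.

Section almost_sure_events.
Context {disp : measure_display} {R : realType}
  {Omega : measurableType disp} (P : probability Omega R).

Lemma ae_eq_set_integral (A B : set Omega) (f : Omega -> \bar R) :
    measurable A -> measurable B -> measurable_fun setT f ->
    {ae P, forall w, A w <-> B w} ->
  (\int[P]_(w in A) f w = \int[P]_(w in B) f w)%E.
Proof.
move=> mA mB mf AB; rewrite integral_mkcond [RHS]integral_mkcond.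
apply: ae_eq_integral => //.
- by apply/(measurable_restrictT _ mA); exact: measurable_funTS.
- by apply/(measurable_restrictT _ mB); exact: measurable_funTS.
- apply: filterS AB => w ABw _; rewrite !patchE.
  rewrite (_ : (w \in A) = (w \in B))//.
  by apply/idP/idP => /set_mem /ABw /mem_set.
Qed.

Lemma ae_eq_probability (A B : set Omega) : measurable A -> measurable B ->
  {ae P, forall w, A w <-> B w} -> P A = P B.
Proof.
move=> mA mB AB.
have := ae_eq_set_integral A B (cst 1%E) mA mB (measurable_cst _) AB.
by rewrite !integral_cst// !mul1e.
Qed.

End almost_sure_events.

(** * Versions of a conditional probability *)

Section conditional_probability.
Context {disp : measure_display} {R : realType}
  {Omega : measurableType disp} {P : probability Omega R}
  {d : nat} (X : 'I_d -> {RV P >-> R}).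

Lemma sigma_measurable G :
  g_sigma_algebra_preimage (random_vector X) G -> measurable G.
Proof.
by move=> [B mB <-]; exact: measurable_random_vector.
Qed.

Lemma sigma_measurable_fun (g : Omega -> R) :
  measurable_fun setT
    (g : g_sigma_algebra_preimageType (random_vector X) -> R) ->
  measurable_fun setT g.
Proof. by move=> mg _ B mB; apply: sigma_measurable; exact: mg. Qed.

(** The event [{g2 < g1}] belongs to sigma(X), so both versions have the same
    integral over it although their difference is positive there: it is null. *)
Lemma is_cond_prob_ae_le E g1 g2 : measurable E ->
  is_cond_prob X E g1 -> is_cond_prob X E g2 ->
  {ae P, forall w, g1 w <= g2 w}.
Proof.
move=> mE [mg1 ig1 g1E] [mg2 ig2 g2E].
pose h := g1 \- g2; pose G := h @^-1` `]0, +oo[.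
have mh : measurable_fun setT
    (h : g_sigma_algebra_preimageType (random_vector X) -> R).
  exact: measurable_funB.
have sG : g_sigma_algebra_preimage (random_vector X) G.
  have := mh measurableT `]0, +oo[%classic (measurable_itv _).
  by rewrite setTI.
have mG := sigma_measurable _ sG.
have ih0 : (\int[P]_(w in G) `|(h w)%:E| = 0)%E.
  rewrite (eq_integral (fun w => (g1 w)%:E - (g2 w)%:E)%E); last first.
    move=> w /set_mem; rewrite /G /= in_itv/= andbT => /ltW h0.
    by rewrite ger0_norm.
  rewrite integralB//; [|exact: integrableS ig1|exact: integrableS ig2].
  by rewrite g1E// g2E// subee// fin_num_measure//; exact: measurableI.
have mhO : measurable_fun G (EFin \o h).
  by apply/measurable_EFinP/measurable_funTS; exact: sigma_measurable_fun.
have /= := (ae_eq_integral_abs P mG mhO).1 ih0.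
apply: filterS => w /= hw; rewrite leNgt; apply/negP => g21.
have Gw : G w by rewrite /G /= in_itv/= andbT subr_gt0.
have [] := hw Gw; move/eqP; rewrite subr_eq0 => /eqP g12.
by move: g21; rewrite g12 ltxx.
Qed.

Lemma is_cond_prob_ae_unique E g1 g2 : measurable E ->
  is_cond_prob X E g1 -> is_cond_prob X E g2 ->
  {ae P, forall w, g1 w = g2 w}.
Proof.
move=> mE g1P g2P; have le12 := is_cond_prob_ae_le _ _ _ mE g1P g2P.
apply: filterS2 le12 (is_cond_prob_ae_le _ _ _ mE g2P g1P) => w g12 g21.
by apply/le_anti; rewrite g12 g21.
Qed.

(** The variance of the version picked by [cond_prob] can be computed on any
    other one. *)
Lemma variance_cond_prob E g : measurable E -> is_cond_prob X E g ->
  ('V_P[cond_prob X E] = 'V_P[g])%E.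
Proof.
move=> mE gP; have cP := cond_probP X mE.
apply: variance_ae_eq.
- by case: cP => + _ _; exact: sigma_measurable_fun.
- by case: gP => + _ _; exact: sigma_measurable_fun.
- exact: is_cond_prob_ae_unique mE cP gP.
Qed.

Lemma is_cond_prob_ae_event (E E' : set Omega) g :
    measurable E -> measurable E' -> {ae P, forall w, E w <-> E' w} ->
  is_cond_prob X E g -> is_cond_prob X E' g.
Proof.
move=> mE mE' EE' [mg ig gE]; split => // G sG; rewrite gE//.
have mG := sigma_measurable _ sG.
apply: ae_eq_probability; [exact: measurableI..|].
by apply: filterS EE' => w EE'; rewrite /setI/= EE'.
Qed.

Lemma is_cond_prob_setC (E : set Omega) g : measurable E ->
  is_cond_prob X E g -> is_cond_prob X (~` E) (cst 1 \- g).
Proof.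
move=> mE [mg ig gE].
have i1 : P.-integrable setT (EFin \o (cst 1%R : Omega -> R)).
  by apply: finite_measure_integrable_cst.
split.
- by apply: measurable_funB.
- rewrite (_ : _ \o _ = (EFin \o (cst 1%R : Omega -> R)) \- (EFin \o g))%E//.
  exact: integrableB.
- move=> G sG; have mG := sigma_measurable _ sG.
  under eq_integral do rewrite /= EFinB.
  rewrite integralB//; [|exact: integrableS i1|exact: integrableS ig].
  rewrite gE// integral_cst// mul1e [in LHS](measureDI P mG mE).
  rewrite (setIC G) addeK; last by rewrite fin_num_measure//; exact: measurableI.
  by rewrite setIC.
Qed.

(** Both sides are finite measures of [B] (the images under X of the measures of
    densities [f] and [g]), which are determined by their values on orthants. It
    is therefore enough to test a candidate for a conditional probability given
    X on the events [{X <= a}]. *)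
Lemma eq_integral_preimage_orthant (f g : Omega -> \bar R) :
    measurable_fun setT f -> measurable_fun setT g ->
    (forall w, 0 <= f w)%E -> (forall w, 0 <= g w)%E ->
    (\int[P]_w f w < +oo)%E ->
    (forall a, \int[P]_(w in random_vector X @^-1` orthant a) f w =
               \int[P]_(w in random_vector X @^-1` orthant a) g w)%E ->
  forall B, measurable B -> (\int[P]_(w in random_vector X @^-1` B) f w =
                             \int[P]_(w in random_vector X @^-1` B) g w)%E.
Proof.
move=> mf mg f0 g0 foo fg B mB.
have mX A : measurable A -> measurable (random_vector X @^-1` A).
  by move=> mA; rewrite -[X in measurable X]setTI; exact: measurable_random_vector.
have density h : measurable_fun setT h -> (forall w, 0 <= h w)%E ->
    exists m : {measure set (d.-tuple R) -> \bar R},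
      forall A, m A = (\int[P]_(w in random_vector X @^-1` A) h w)%E.
  move=> mh h0.
  pose nu A := (\int[P]_(w in random_vector X @^-1` A) h w)%E.
  have nu0 : nu set0 = 0%E by rewrite /nu preimage_set0 integral_set0.
  have nu_ge0 A : (0 <= nu A)%E by apply: integral_ge0.
  have nu_add : semi_sigma_additive nu.
    move=> /= F mF tF mUF; rewrite /nu; apply: cvg_toP.
      apply: ereal_nondecreasing_is_cvgn => m n mn.
      by apply: lee_sum_nneg_natr => // k _ _; exact: integral_ge0.
    rewrite preimage_bigcup ge0_integral_bigcup//=.
    - by move=> k; exact: mX.
    - exact: measurable_funTS.
    - apply/trivIsetP => i j _ _ ij; rewrite -preimage_setI.
      by move/trivIsetP : tF => ->//; rewrite preimage_set0.
  pose m : {measure set (d.-tuple R) -> \bar R} :=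
    HB.pack nu (isMeasure.Build _ _ _ nu nu0 nu_ge0 nu_add).
  by exists m.
have [mf' mfE] := density f mf f0.
have [mg' mgE] := density g mg g0.
rewrite -mfE -mgE; apply: eq_measure_orthant => // a; first by rewrite mfE mgE.
rewrite mfE; apply: le_lt_trans foo; apply: ge0_subset_integral => //.
by apply: mX; exact: measurable_orthant.
Qed.

End conditional_probability.

(** * The copula measure and the grades *)

Section copula_measure.
Context {disp : measure_display} {R : realType}
  {Omega : measurableType disp} {P : probability Omega R}
  {d : nat} (X : 'I_d -> {RV P >-> R}) (Y : {RV P >-> R}).
Hypothesis contX : forall i, continuous (distribution_function (X i)).
Hypothesis contY : continuous (distribution_function Y).

(** The vector [(F_1(X_1), ..., F_d(X_d))] is kept in the form [grade_map] of X,
    since measurability with respect to sigma(X) is read off that form. *)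
Definition grade_map (x : d.-tuple R) : d.-tuple R :=
  [tuple distribution_function (X i) (tnth x i) | i < d].

Definition grades (w : Omega) : d.-tuple R := grade_map (random_vector X w).

Lemma tnth_grades w i : tnth (grades w) i = distribution_function (X i) (X i w).
Proof. by rewrite !tnth_mktuple. Qed.

Lemma measurable_grade_map : measurable_fun setT grade_map.
Proof.
apply/measurable_fun_tnthP => i.
rewrite (_ : _ \o _ = distribution_function (X i) \o (@tnth _ R)^~ i).
  apply: measurableT_comp; last exact: measurable_tnth.
  exact: measurable_distribution_function.
by apply/funext => x /=; rewrite tnth_mktuple.
Qed.

Lemma measurable_grades : measurable_fun setT grades.
Proof.
apply: measurableT_comp; first exact: measurable_grade_map.
exact: measurable_random_vector.
Qed.

Lemma unit_cube_grades w : @unit_cube R d (grades w).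
Proof.
move=> i; rewrite tnth_grades tnth_mktuple in_itv/=.
by rewrite distribution_function_ge0 distribution_function_le1.
Qed.

Lemma measurable_box (u : d.-tuple R) : measurable (box u).
Proof.
rewrite (_ : box u =
    \bigcap_(i in [set: 'I_d]) ((@tnth _ R)^~ i @^-1` `[0, tnth u i])).
  apply: fin_bigcap_measurable => // i _.
  by rewrite -[X in measurable X]setTI; exact: measurable_tnth.
by apply/seteqP; split => [x ux i _|x ux i]; [exact: ux|exact: ux].
Qed.

Lemma measurable_grades_preimage B :
  measurable B -> measurable (grades @^-1` B).
Proof. by move=> mB; rewrite -[X in measurable X]setTI; exact: measurable_grades. Qed.

Lemma measurable_le_grade t : measurable [set w | distribution_function Y (Y w) <= t].
Proof.
rewrite [X in measurable X](_ : _ =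
    (distribution_function Y \o Y) @^-1` `]-oo, t]%classic).
  rewrite -[X in measurable X]setTI; apply: measurableT_comp => //.
  exact: measurable_distribution_function.
by apply/seteqP; split => w; rewrite /= in_itv.
Qed.

(** Passing to the grades loses nothing up to null events: where the two events
    differ, some [F_i(X_i)] takes the value [F_i(x_i)], and it has no atom. *)
Lemma orthant_grades (x : d.-tuple R) :
  {ae P, forall w, orthant x (random_vector X w) <-> orthant (grade_map x) (grades w)}.
Proof.
have h i : {ae P, forall w, distribution_function (X i) (X i w) <>
                            distribution_function (X i) (tnth x i)}.
  exists [set w | distribution_function (X i) (X i w) =
                  distribution_function (X i) (tnth x i)]; split.
  - have m : measurable_fun setT (distribution_function (X i) \o X i).
      by apply: measurableT_comp => //; exact: measurable_distribution_function.
    have := m measurableT [set distribution_function (X i) (tnth x i)].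
    by rewrite setTI; apply.
  - exact: distribution_function_fiber0.
  - by move=> w /= /contrapT.
have : {ae P, forall w, forall i, distribution_function (X i) (X i w) <>
                                  distribution_function (X i) (tnth x i)}.
  exact: (@filter_forall _ _ _ (almost_everywhere P) _ h).
apply: filterS => w hw; split => xw i.
  rewrite tnth_grades tnth_mktuple; apply: distribution_function_nd.
  by have := xw i; rewrite tnth_mktuple.
have := xw i; rewrite tnth_grades !tnth_mktuple => Fle.
rewrite leNgt; apply/negP => /ltW xX; apply: (hw i).
by apply/le_anti; rewrite Fle distribution_function_nd.
Qed.

Context (mu : probability (d.-tuple R * R)%type R).
Hypothesis hmu : is_copula_measure (connecting_copula X Y) mu.

Lemma copula_measure_unit_cube : mu (@unit_cube R d `*` `[0, 1]) = 1%E.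
Proof.
rewrite hmu//; last 2 first.
- by move=> i; rewrite !tnth_mktuple in_itv/= ler01 lexx.
- by rewrite in_itv/= ler01 lexx.
rewrite /connecting_copula (_ : [set w | _] = setT) ?probability_setT//.
apply/seteqP; split => // w _; split => [i|]; last exact: distribution_function_le1.
by rewrite tnth_mktuple distribution_function_le1.
Qed.

Lemma copula_measure_concentrated (E : set (d.-tuple R)) (F : set R) :
    measurable E -> measurable F ->
  mu (E `*` F) = mu ((E `&` @unit_cube R d) `*` (F `&` `[0, 1])).
Proof.
move=> mE mF.
have mC : measurable (@unit_cube R d `*` `[0, 1]%classic : set (d.-tuple R * R)).
  by apply: measurableX => //; exact: measurable_box.
have mEF := measurableX mE mF.
rewrite [LHS](measureDI mu mEF mC) setXI -[RHS]add0e; congr (_ + _)%E.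
apply/eqP; rewrite -measure_le0.
rewrite -[leRHS](_ : mu (~` (@unit_cube R d `*` `[0, 1])) = 0%E); last first.
  by rewrite probability_setC// copula_measure_unit_cube subee.
by apply: le_measure; rewrite ?inE;
  [exact: measurableD|exact: measurableC|by move=> x []].
Qed.

(** [is_copula_measure] only speaks of boxes with corner in the unit cube. An
    orthant meets the cube in such a box, or not at all if some coordinate of
    its corner is negative. *)
Lemma copula_measure_orthant (a : d.-tuple R) t : 0 <= t <= 1 ->
  mu (orthant a `*` `[0, t]) =
  P [set w | orthant a (grades w) /\ distribution_function Y (Y w) <= t].
Proof.
move=> /andP[t0 t1].
rewrite copula_measure_concentrated//; last exact: measurable_orthant.
rewrite (_ : `[0, t] `&` `[0, 1] = `[0, t]%classic); last first.
  apply/seteqP; split => s /=; rewrite !in_itv/=; first by case.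
  by move=> /andP[-> st]; split => //; exact: le_trans st t1.
have [a0|] := boolP [forall i, 0 <= tnth a i]; last first.
  rewrite negb_forall => /existsP[i]; rewrite -ltNge => a0.
  rewrite (_ : orthant a `&` _ = set0); last first.
    rewrite -subset0 => x [/(_ i) xa /(_ i)]; rewrite tnth_mktuple in_itv/=.
    by move=> /andP[x0 _]; have := le_lt_trans (le_trans x0 xa) a0; rewrite ltxx.
  rewrite set0X measure0 (_ : [set w | _] = set0) ?measure0//.
  rewrite -subset0 => w /= [/(_ i)]; rewrite tnth_grades => Fa _.
  by have := le_lt_trans Fa a0; rewrite ltNge distribution_function_ge0.
pose a1 := [tuple Num.min (tnth a i) 1 | i < d].
rewrite (_ : orthant a `&` _ = box a1); last first.
  apply/seteqP; split => [x [xa x1] i|x xa1]; [|split => i].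
  - have := x1 i; rewrite !tnth_mktuple !in_itv/= le_min => /andP[-> ->].
    by rewrite xa.
  - by have := xa1 i; rewrite !tnth_mktuple in_itv/= le_min => /and3P[].
  - by have := xa1 i; rewrite !tnth_mktuple !in_itv/= le_min => /and3P[-> _ ->].
rewrite hmu; last 2 first.
- move=> i; rewrite !tnth_mktuple in_itv/= le_min ler01 (forallP a0 i)/=.
  by rewrite ge_min lexx orbT.
- by rewrite in_itv/= t0.
rewrite /connecting_copula.
rewrite [X in P X](_ : _ = grades @^-1` orthant a `&`
    [set w | distribution_function Y (Y w) <= t]).
  rewrite fineK// fin_num_measure//.
  apply: measurableI; last exact: measurable_le_grade.
  by apply: measurable_grades_preimage; exact: measurable_orthant.
apply/seteqP; split => w /= [Fa Ft]; split => // i.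
  by rewrite tnth_grades; have := Fa i; rewrite tnth_mktuple le_min => /andP[].
by rewrite tnth_mktuple le_min -tnth_grades Fa tnth_grades distribution_function_le1.
Qed.

Definition grades_mfun : {mfun Omega >-> d.-tuple R} :=
  HB.pack grades (isMeasurableFun.Build _ _ _ _ grades measurable_grades).

Lemma marginal_copula_measure (E : set (d.-tuple R)) : measurable E ->
  marginal mu E = distribution P grades_mfun E.
Proof.
apply: eq_measure_orthant => a; have ma := measurable_orthant a; last first.
  exact: le_lt_trans (probability_le1 _ ma) (ltry 1).
transitivity (mu (orthant a `*` setT)).
  by rewrite setXT.
rewrite copula_measure_concentrated// setTI.
transitivity (mu (orthant a `*` `[0, 1])).
  by rewrite [RHS]copula_measure_concentrated// setIid.
rewrite copula_measure_orthant ?ler01 ?lexx//; congr (P _).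
apply/seteqP; split => w /=; first by case.
by move=> aw; split => //; exact: distribution_function_le1.
Qed.

Lemma ge0_integral_marginal (D : set (d.-tuple R)) (f : d.-tuple R -> \bar R) :
    measurable D -> measurable_fun D f -> (forall u, D u -> (0 <= f u)%E) ->
  (\int[marginal mu]_(u in D) f u =
   \int[P]_(w in grades @^-1` D) f (grades w))%E.
Proof.
move=> mD mf f0.
rewrite (eq_measure_integral (distribution P grades_mfun)); last first.
  by move=> A mA _; exact: marginal_copula_measure.
by rewrite ge0_integral_pushforward// => u /set_mem; exact: f0.
Qed.

Context (K : R.-pker (d.-tuple R) ~> R).
Hypothesis hK : is_markov_kernel mu K.

Definition kernel_cdf (t : R) (u : d.-tuple R) : R := fine (K u `[0, t]%classic).

Lemma kernel_le1 t u : (K u `[0%R, t]%classic <= 1)%E.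
Proof. by rewrite -(prob_kernel (s := K) u) le_measure ?inE. Qed.

Lemma kernel_cdfE t u : (kernel_cdf t u)%:E = K u `[0, t]%classic.
Proof.
rewrite /kernel_cdf fineK// ge0_fin_numE//.
exact: le_lt_trans (kernel_le1 t u) (ltry 1).
Qed.

Lemma kernel_cdf_bounds t u : 0 <= kernel_cdf t u <= 1.
Proof. by rewrite -!lee_fin kernel_cdfE measure_ge0/= kernel_le1. Qed.

Lemma measurable_kernel_cdf t : measurable_fun setT (kernel_cdf t).
Proof.
apply: (@measurableT_comp _ _ _ _ _ _ fine) => //.
exact: measurable_kernel.
Qed.

Lemma measurable_kernel_cdf_grades t : measurable_fun setT (kernel_cdf t \o grades).
Proof.
apply: measurableT_comp; first exact: measurable_kernel_cdf.
exact: measurable_grades.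
Qed.

Lemma kernel_cdf_Lfun2 t : kernel_cdf t \o grades \in Lfun P 2%:E.
Proof.
apply: unit_valued_Lfun2; first exact: measurable_kernel_cdf_grades.
by move=> w; exact: kernel_cdf_bounds.
Qed.

(** On [{X <= a}], that is on [{Z <= F(a)}], both integrals equal
    [mu ({u <= F(a)} `*` [0, t])]: the left one by definition of the copula of
    (X, Y), the right one by disintegration of [mu] along [K]. *)
Lemma kernel_cdf_is_cond_prob t : 0 <= t <= 1 ->
  is_cond_prob X [set w | distribution_function Y (Y w) <= t]
    (kernel_cdf t \o grades).
Proof.
move=> t01; set V := [set w | _].
have mV : measurable V by exact: measurable_le_grade.
have mW := measurable_kernel_cdf_grades t.
have mfV : measurable_fun setT (EFin \o (\1_V : Omega -> R)).
  exact/measurable_EFinP/measurable_indic.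
have mX a : measurable (random_vector X @^-1` orthant a).
  by rewrite -[X in measurable X]setTI; apply: measurable_random_vector => //;
    exact: measurable_orthant.
have VW G : g_sigma_algebra_preimage (random_vector X) G ->
    (\int[P]_(w in G) (\1_V w : R)%:E = \int[P]_(w in G) (kernel_cdf t (grades w))%:E)%E.
  move=> [B mB <-]; rewrite setTI.
  apply: (eq_integral_preimage_orthant X
    (EFin \o \1_V) (EFin \o (kernel_cdf t \o grades))) => //.
  - exact/measurable_EFinP.
  - by move=> w; rewrite lee_fin.
  - by move=> w; rewrite lee_fin; case/andP : (kernel_cdf_bounds t (grades w)).
  - rewrite /= integral_indic// setIT.
    exact: le_lt_trans (probability_le1 _ mV) (ltry 1).
  move=> a; have mga := measurable_orthant (grade_map a).
  rewrite (ae_eq_set_integral P _ (grades @^-1` orthant (grade_map a)))//; last 2 first.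
  - exact: measurable_grades_preimage.
  - exact: orthant_grades.
  rewrite [RHS](ae_eq_set_integral P _ (grades @^-1` orthant (grade_map a)))//; last 3 first.
  - exact: measurable_grades_preimage.
  - exact/measurable_EFinP.
  - exact: orthant_grades.
  rewrite integral_indic//; last exact: measurable_grades_preimage.
  rewrite -(ge0_integral_marginal _ (EFin \o kernel_cdf t))//; last 2 first.
  - by apply/measurable_EFinP/measurable_funTS; exact: measurable_kernel_cdf.
  - by move=> u _; rewrite lee_fin; case/andP : (kernel_cdf_bounds t u).
  under eq_integral do rewrite /= kernel_cdfE.
  by rewrite -hK// copula_measure_orthant// setIC.
split.
- move=> _ B mB; rewrite setTI.
  exists ((kernel_cdf t \o grade_map) @^-1` B); last by rewrite setTI.
  rewrite -[X in measurable X]setTI; apply: measurableT_comp => //.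
    exact: measurable_kernel_cdf.
  exact: measurable_grade_map.
- apply/Lfun1_integrable; apply: Lfun_subset12; last exact: kernel_cdf_Lfun2.
  by rewrite fin_num_measure.
- move=> G sG; rewrite -VW// integral_indic//.
  exact: (sigma_measurable X _ sG).
Qed.

(** [{G(Y) > G(y)}] is contained in [{Y >= y}], and the difference lies in the
    null event [{G(Y) = G(y)}]. *)
Lemma ge_event_ae y :
  {ae P, forall w, (~` [set w | distribution_function Y (Y w) <=
                               distribution_function Y y]) w <-> [set w | y <= Y w] w}.
Proof.
have mFY : measurable_fun setT (distribution_function Y \o Y).
  by apply: measurableT_comp => //; exact: measurable_distribution_function.
exists [set w | distribution_function Y (Y w) = distribution_function Y y]; split.
- have := mFY measurableT [set distribution_function Y y].
  by rewrite setTI; apply.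
- exact: distribution_function_fiber0.
- move=> w /= nE; apply: contrapT => FYy; apply: nE; split => [/negP|yY].
    rewrite -ltNge => /ltW Fle; rewrite leNgt; apply/negP => /ltW Yy; apply: FYy.
    by apply/le_anti; rewrite Fle distribution_function_nd.
  move=> Fle; apply: FYy; apply/le_anti.
  by rewrite Fle distribution_function_nd.
Qed.

Lemma measurable_ge_event y : measurable [set w | y <= Y w].
Proof.
rewrite [X in measurable X](_ : _ = Y @^-1` `[y, +oo[%classic).
  by rewrite -[X in measurable X]setTI; exact: measurable_funPT.
by apply/seteqP; split => w; rewrite /= in_itv/= andbT.
Qed.

Lemma variance_ge_event y :
  let t := distribution_function Y y in
  ('V_P[(\1_[set w | (y <= Y w)%R] : Omega -> R)] = (t - t ^+ 2)%:E)%E.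
Proof.
move=> t; set E := [set w | y <= Y w].
have mE : measurable E := measurable_ge_event y.
have t01 : 0 <= t <= 1.
  by rewrite distribution_function_ge0 distribution_function_le1.
have mV := measurable_le_grade t.
have PE : P E = (1 - t)%:E.
  rewrite -(ae_eq_probability P _ _ (measurableC mV) mE (ge_event_ae y)).
  by rewrite probability_setC// probability_integral_transform// EFinB.
rewrite varianceE; last first.
  apply: unit_valued_Lfun2 => // w; rewrite indicE.
  by case: (_ \in _); rewrite /= ?lexx ?ler01.
rewrite (_ : \1_E ^+ 2 = \1_E); last first.
  apply/funext => w; rewrite fctE indicE.
  by case: (_ \in _); rewrite ?expr1n ?expr0n.
rewrite expectation_indic// PE -EFin_expe -EFinB; congr EFin; ring.
Qed.

Lemma psi_diag t : (psi mu K t t)%:E = ('E_P[(kernel_cdf t \o grades) ^+ 2])%E.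
Proof.
rewrite expectation.unlock /psi /Rintegral.
rewrite ge0_integral_marginal; last 3 first.
- exact: measurable_box.
- apply/measurable_EFinP/measurable_funTS.
  by apply: measurable_funM; exact: measurable_kernel_cdf.
- move=> u _; rewrite lee_fin; have /andP[k0 _] := kernel_cdf_bounds t u.
  exact: mulr_ge0.
rewrite (_ : grades @^-1` _ = setT); last first.
  by apply/seteqP; split => // w _; exact: unit_cube_grades.
rewrite fineK//.
apply: integrable_fin_num => //.
by apply: Lfun2_integrable_sqr; exact: kernel_cdf_Lfun2.
Qed.

Lemma variance_kernel_cdf t : 0 <= t <= 1 ->
  ('V_P[kernel_cdf t \o grades] = (psi mu K t t - t ^+ 2)%:E)%E.
Proof.
move=> t01; rewrite varianceE; last exact: kernel_cdf_Lfun2.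
rewrite -psi_diag EFinB; congr (_ - _)%E.
suff -> : ('E_P[kernel_cdf t \o grades] = t%:E)%E by rewrite EFin_expe.
have [_ _ /(_ setT)] := kernel_cdf_is_cond_prob _ t01.
rewrite setIT expectation.unlock => ->; first exact: probability_integral_transform.
by exists setT => //; rewrite setTI preimage_setT.
Qed.

Lemma variance_cond_prob_ge y :
  let t := distribution_function Y y in
  ('V_P[cond_prob X [set w | (y <= Y w)%R]] = (psi mu K t t - t ^+ 2)%:E)%E.
Proof.
move=> t; have t01 : 0 <= t <= 1.
  by rewrite distribution_function_ge0 distribution_function_le1.
have mV := measurable_le_grade t.
have WE : is_cond_prob X [set w | y <= Y w] (cst 1 \- (kernel_cdf t \o grades)).
  apply: (is_cond_prob_ae_event X _ _ _ _ (measurable_ge_event y) (ge_event_ae y)).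
    exact: measurableC.
  by apply: is_cond_prob_setC => //; exact: kernel_cdf_is_cond_prob.
rewrite (variance_cond_prob X _ _ (measurable_ge_event y) WE).
by rewrite varianceB_cst_l ?variance_kernel_cdf//; exact: kernel_cdf_Lfun2.
Qed.

(** Nonnegativity of the integrand [psi(t, t) - t^2] on the whole unit interval,
    needed for the change of variable [t = G(y)]. *)
Lemma psi_ge_sqr t : 0 <= t <= 1 -> t ^+ 2 <= psi mu K t t.
Proof.
by move=> t01; rewrite -subr_ge0 -lee_fin -variance_kernel_cdf// variance_ge0.
Qed.

(** Monotonicity is how the diagonal of psi is seen to be measurable. *)
Lemma psi_diag_nd : {homo (fun t => psi mu K t t) : s t / s <= t}.
Proof.
move=> s t st; rewrite -lee_fin !psi_diag; apply: expectation_le.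
- exact: (measurable_funX 2 (measurable_kernel_cdf_grades s)).
- exact: (measurable_funX 2 (measurable_kernel_cdf_grades t)).
- by move=> w; exact: sqr_ge0.
- by move=> w; exact: sqr_ge0.
- apply: aeW => w; have /andP[k0 _] := kernel_cdf_bounds s (grades w).
  rewrite /= !expr2; apply: ler_pM => //.
    rewrite -lee_fin !kernel_cdfE le_measure ?inE//.
    by apply: subset_itvl; rewrite bnd_simp.
  rewrite -lee_fin !kernel_cdfE le_measure ?inE//.
  by apply: subset_itvl; rewrite bnd_simp.
Qed.

Lemma psi_diag_le1 t : psi mu K t t <= 1.
Proof.
rewrite -lee_fin psi_diag -(expectation_cst P 1); apply: expectation_le => //.
- exact: (measurable_funX 2 (measurable_kernel_cdf_grades t)).
- by move=> w; exact: sqr_ge0.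
- apply: aeW => w; have /andP[k0 k1] := kernel_cdf_bounds t (grades w).
  by rewrite /= expr2 mulr_ile1.
Qed.

End copula_measure.

(** * Integration over the unit interval *)

Lemma Rintegral_exprn (R : realType) n :
  \int[lebesgue_measure]_(x in `[0, 1]) (x ^+ n) = n.+1%:R^-1 :> R.
Proof.
rewrite Rintegration_by_substitution_onem ?lexx ?ler01//.
  by rewrite unstable.onem1 Rintegral_onemXn.
by apply: continuous_subspaceT => x; exact: exprn_continuous.
Qed.

Lemma continuous_integrable01 (R : realType) (f : R -> R) : continuous f ->
  (@lebesgue_measure R).-integrable `[0, 1] (EFin \o f).
Proof.
move=> cf; apply: continuous_compact_integrable; first exact: segment_compact.
exact: continuous_subspaceT.
Qed.

Theorem theorem4 (R : realType) (disp : measure_display)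
    (Omega : measurableType disp) (P : probability Omega R)
    (d : nat) (d_gt0 : (0 < d)%N)
    (X : 'I_d -> {RV P >-> R}) (Y : {RV P >-> R})
    (contX : forall i, continuous (distribution_function (X i)))
    (contY : continuous (distribution_function Y))
    (A : d.-tuple R -> R -> R) (hA : A = connecting_copula X Y)
    (mu : probability (d.-tuple R * R)%type R) (hmu : is_copula_measure A mu)
    (K : R.-pker (d.-tuple R) ~> R) (hK : is_markov_kernel mu K) :
  coefT Y X = phi (psi mu K).
Proof.
subst A.
have sqr_le t : t \in `[0, 1] -> t ^+ 2 <= psi mu K t t.
  by rewrite in_itv => /= t01; exact: (psi_ge_sqr X Y contX contY mu hmu K hK).
have mpsi : measurable_fun setT (fun t => psi mu K t t).
  apply: nondecreasing_measurable => //.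
  exact: (psi_diag_nd X Y mu hmu K).
have numE : (\int[distribution P Y]_y 'V_P[cond_prob X [set w | (y <= Y w)%R]] =
    \int[lebesgue_measure]_(t in `[0%R, 1%R]) (psi mu K t t - t ^+ 2)%:E)%E.
  rewrite -(ge0_integral_distribution_function _ _ _ _ Y
    (fun t => (psi mu K t t - t ^+ 2)%:E))//.
  - apply: eq_integral => y _.
    by rewrite (variance_cond_prob_ge X Y contX contY mu hmu K hK).
  - apply/measurable_EFinP/measurable_funTS; exact: measurable_funB.
  - by move=> t t01; rewrite lee_fin subr_ge0 sqr_le.
have denE : (\int[distribution P Y]_y
      'V_P[(\1_[set w | (y <= Y w)%R] : Omega -> R)] =
    \int[lebesgue_measure]_(t in `[0%R, 1%R]) (t - t ^+ 2)%:E)%E.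
  rewrite -(ge0_integral_distribution_function _ _ _ _ Y
    (fun t => (t - t ^+ 2)%:E))//.
  - by apply: eq_integral => y _; rewrite variance_ge_event.
  - apply/measurable_EFinP/measurable_funTS; exact: measurable_funB.
  - move=> t; rewrite in_itv/= => /andP[t0 t1].
    by rewrite lee_fin subr_ge0 expr2 ler_piMr.
have ipsi : (@lebesgue_measure R).-integrable `[0, 1] (EFin \o (fun t => psi mu K t t)).
  apply: measurable_bounded_integrable => //.
  - by rewrite /= lebesgue_measure_itv/= lte_fin ltr01 sube0 ltry.
  - exact: measurable_funTS.
  - exists 1; split => // M M1 t /= t01; rewrite ger0_norm; last first.
      exact: le_trans (sqr_ge0 t) (sqr_le _ t01).
    by apply: le_trans (ltW M1); exact: (psi_diag_le1 X Y mu hmu K).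
have iid : (@lebesgue_measure R).-integrable `[0, 1] (EFin \o (fun t : R => t)).
  by apply: continuous_integrable01 => t; exact: cvg_id.
have isqr : (@lebesgue_measure R).-integrable `[0, 1] (EFin \o (fun t : R => t ^+ 2)).
  by apply: continuous_integrable01; exact: exprn_continuous.
rewrite /coefT numE denE -!/(Rintegral _ _ _) !RintegralB// Rintegral_exprn.
have -> : \int[lebesgue_measure]_(t in `[0, 1]) t = 2^-1 :> R.
  by rewrite -(Rintegral_exprn R 1); apply: eq_Rintegral => t _; rewrite expr1.
rewrite /phi; set I := Rintegral _ _ _.
by field.
Qed.
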